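(* Let $A$ be a Banach algebra with a sequential contractive approximate identity ${\mathfrak e}=(e_n)$. If $Q_{\mathfrak e}(A)$ is weak* closed in $A^*$, then $A$ possesses a sequential contractive approximate identity contained in ${\mathfrak r}^{\mathfrak e}_A$. Moreover, for every $a\in A$ with $\inf\{\mathrm{Re}\,\varphi(a):\varphi\in S_{\mathfrak e}(A)\}>-1$, there is a sequential contractive approximate identity $(f_n)$ in ${\mathfrak r}^{\mathfrak e}_A$ such that $f_n+a\in{\mathfrak r}^{\mathfrak e}_A$ for all $n$.
   Context: Banach algebras are complex with submultiplicative norm. A contractive approximate identity (cai) is a net (here a sequence) $(e_n)$ with $\|e_n\|\le1$ and $e_na\to a$, $ae_n\to a$ for all $a\in A$. For the fixed cai ${\mathfrak e}=(e_n)$: $S_{\mathfrak e}(A)=\{\varphi\in A^*:\|\varphi\|\le 1,\ \lim_n\varphi(e_n)=1\}$; $Q_{\mathfrak e}(A)=\{t\varphi: t\in[0,1],\ \varphi\in S_{\mathfrak e}(A)\}$; ${\mathfrak r}^{\mathfrak e}_A=\{x\in A:\mathrm{Re}\,\varphi(x)\ge 0$ for all $\varphi\in S_{\mathfrak e}(A)\}$. *)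

(* Defs.v *)
From HB Require Import structures.
From mathcomp Require Import all_boot all_order all_algebra.
From mathcomp Require Import complex.
From mathcomp Require Import all_classical all_reals all_analysis.
Set Implicit Arguments. Unset Strict Implicit. Unset Printing Implicit Defensive.
Import Order.TTheory GRing.Theory Num.Theory.
Import numFieldNormedType.Exports.
Local Open Scope ring_scope.
Local Open Scope classical_set_scope.

HB.instance Definition _ (R : realType) := GRing.Lmodule.copy R[i] R[i]^o.
HB.instance Definition _ (R : realType) := NormedModule.copy R[i] R[i]^o.

Section BA.
Variables (R : realType) (A : completeNormedModType R[i]).

Definition banach_algebra_mul (mul : A -> A -> A) : Prop :=
  [/\ (forall x y z, mul x (mul y z) = mul (mul x y) z),
      (forall (c : R[i]) x y z, mul (c *: x + y) z = c *: mul x z + mul y z),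
      (forall (c : R[i]) x y z, mul z (c *: x + y) = c *: mul z x + mul z y) &
      (forall x y, `|mul x y| <= `|x| * `|y|)].

Definition clinear (phi : A -> R[i]) : Prop :=
  forall (c : R[i]) x y, phi (c *: x + y) = c * phi x + phi y.

Definition dual : set (A -> R[i]) := [set phi | clinear phi /\ continuous phi].

Definition dual_ball : set (A -> R[i]) :=
  [set phi | dual phi /\ forall x, `|phi x| <= `|x|].

Definition seq_cai (mul : A -> A -> A) (e : nat -> A) : Prop :=
  (forall n, `|e n| <= 1) /\
  (forall a, (fun n => mul (e n) a) @ \oo --> a) /\
  (forall a, (fun n => mul a (e n)) @ \oo --> a).

Definition S_e (e : nat -> A) : set (A -> R[i]) :=
  [set phi | dual_ball phi /\ (fun n => phi (e n)) @ \oo --> (1 : R[i])].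

Definition Q_e (e : nat -> A) : set (A -> R[i]) :=
  [set psi | exists t : R, exists2 phi, S_e e phi &
     [/\ 0 <= t, t <= 1 & psi = (fun x => (t%:C)%C * phi x)]].

Definition r_e (e : nat -> A) : set A :=
  [set x | forall phi, S_e e phi -> 0 <= complex.Re (phi x)].

(* weak* closedness of a subset of A^*: closed in A^* for the weak* topology,
   i.e. the topology of pointwise convergence restricted to A^* *)
Definition weakstar_closed (Q : set (A -> R[i])) : Prop :=
  Q `<=` dual /\ @closure {ptws A -> R[i]} Q `&` dual `<=` Q.

End BA.

(* Main.v *)
(* On an element t phi' of Q_e, with phi' in S_e, the e n converge to t. Hence, if
   Re phi z >= - r for all phi in S_e, with r < 1, the functions Re (z + r e n)
   on Q_e have a nonnegative pointwise limit. As Q_e is weak* compact, they and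
   their convex combinations attain their minima, and Simons' inequality yields a
   convex combination g of the e n, n >= N, with Re phi (z + r g) >= - eps on Q_e.
   To remove eps, spend at each step a fraction r of the mass still to be
   distributed: the error left at a stage is compensated by the remaining mass,
   so the resulting infinite convex combination f satisfies Re phi f >= 0 and
   Re phi (f + a) >= 0 exactly. Taking the n-th f in the closed convex hull of
   the e k, k >= n, gives an approximate identity. The first claim is a = 0. *)
Require Import Defs.
From HB Require Import structures.
From mathcomp Require Import all_boot all_order all_algebra.
From mathcomp Require Import complex lra ring.
From mathcomp Require Import all_classical all_reals all_analysis.
Set Implicit Arguments. Unset Strict Implicit. Unset Printing Implicit Defensive.
Import Order.TTheory GRing.Theory Num.Theory.
Import numFieldNormedType.Exports.
Local Open Scope ring_scope.
Local Open Scope classical_set_scope.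

(** * The real-valued norm and sequential limits *)

Section RealNorm.
Variables (R : realType) (V : normedModType R[i]).
Implicit Types (x y : V) (u : nat -> V).

(** Norms take values in [R[i]]; the real part brings estimates back to the ordered field [R]. *)
Definition nrm x : R := complex.Re `|x|.

Lemma nrmE x : (nrm x)%:C%C = `|x|.
Proof. by rewrite /nrm RRe_real. Qed.

Lemma nrm_ge0 x : 0 <= nrm x.
Proof. by rewrite -ler0c nrmE. Qed.

Lemma ler_nrmD x y : nrm (x + y) <= nrm x + nrm y.
Proof. by rewrite -lecR rmorphD/= !nrmE ler_normD. Qed.

Lemma nrmN x : nrm (- x) = nrm x.
Proof. by rewrite /nrm normrN. Qed.

Lemma nrmB x y : nrm (x - y) = nrm (y - x).
Proof. by rewrite -nrmN opprB. Qed.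

Lemma nrm0 : nrm (0 : V) = 0.
Proof. by rewrite /nrm normr0. Qed.

Lemma nrmZ (c : R) x : 0 <= c -> nrm (c%:C%C *: x) = c * nrm x.
Proof.
move=> c0; apply: complexI; rewrite nrmE normrZ rmorphM/= nrmE.
by congr (_ * _); rewrite ger0_norm// lecR.
Qed.

Lemma ler_nrm_dist x y z : nrm (x - z) <= nrm (x - y) + nrm (y - z).
Proof. by rewrite -[x - z](subrKA y) ler_nrmD. Qed.

Lemma nrm_eq0_small x :
  (forall eps : R, 0 < eps -> nrm x <= eps) -> x = 0.
Proof.
move=> small; apply/normr0_eq0; rewrite -nrmE; congr (_%:C)%C.
apply/eqP; rewrite eq_le nrm_ge0 andbT.
by apply/ler_addgt0Pr => eps /small; rewrite add0r.
Qed.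

Lemma ltc_posP (eps : R[i]) : 0 < eps -> exists2 d : R, 0 < d & eps = d%:C%C.
Proof.
move=> eps0; exists (complex.Re eps); first by move: eps0; rewrite ltcE => /andP[].
by rewrite RRe_real// gtr0_real.
Qed.

Lemma cvg_nrmP u x : u @ \oo --> x <->
  forall eps : R, 0 < eps -> exists N, forall n, (N <= n)%N -> nrm (u n - x) < eps.
Proof.
split=> [/cvgrPdistC_lt ux eps eps0|ux].
  have [|N _ NP] := ux eps%:C%C; first by rewrite ltcR.
  by exists N => n /NP /=; rewrite -nrmE ltcR.
apply/cvgrPdistC_lt => _ /ltc_posP[d d0 ->].
have [N NP] := ux _ d0; exists N => // n /NP /=.
by rewrite -nrmE ltcR.
Qed.

End RealNorm.

Lemma ler_Re_nrm (R : realType) (z : R[i]) : `|complex.Re z| <= nrm z.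
Proof.
rewrite /nrm normc_def/= -sqrtr_sqr ler_wsqrtr// lerDl sqr_ge0 //.
Qed.

Lemma exprn_small (R : realType) (q eps : R) : 0 <= q < 1 -> 0 < eps ->
  exists N, forall n, (N <= n)%N -> q ^+ n < eps.
Proof.
move=> /andP[q0 q1] eps0; have : `|q| < 1 by rewrite ger0_norm.
move=> /cvg_expr/cvgrPdist_lt/(_ _ eps0)[N _ NP]; exists N => n /NP /=.
by rewrite sub0r normrN ger0_norm// exprn_ge0.
Qed.

Lemma cauchy_nrm_cvg (R : realType) (V : completeNormedModType R[i])
    (u : nat -> V) :
  (forall eps : R, 0 < eps -> exists N, forall n, (N <= n)%N ->
    nrm (u n - u N) < eps) ->
  exists x : V, u @ \oo --> x.
Proof.
move=> cu; apply/cvg_ex/cauchy_cvgP/cauchy_exP => _ /ltc_posP[d d0 ->].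
have [N NP] := cu _ d0; exists (u N); exists N => // n /NP /=.
by rewrite -ball_normE /= distrC -nrmE ltcR.
Qed.

(** * Simons' inequality *)

Section Simons.
Variables (R : realType) (V T : Type) (F : V -> T -> R) (C : nat -> set V).

(* The proof is the one of Simons' inequality: [g n] almost minimises the
   supremum of [a n + F (g n)], where [a n] is the sum of [2 ^ (n - k - 1) F (g k)]
   over [k < n], and the maximum point [x] of the infinite series is the
   point where the tails of the series are compared with 0. *)
Lemma simons (x0 : T) (eps : R) : 0 < eps ->
  (forall n, C n !=set0) ->
  (exists B, forall n v, C n v -> - B <= F v x0) ->
  (forall g, (forall n, C n (g n)) -> exists t, forall n, C n (t n) /\
     forall x, F (t n) x = (F (g n) x + F (t n.+1) x) / 2) ->
  (forall v, C 0%N v -> exists x, forall y, F v y <= F v x) ->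
  (forall x, exists n, forall v, C n v -> F v x <= eps) ->
  exists2 v, C 0%N v & forall x, F v x <= 3 * eps.
Proof.
move=> eps0 C0 [B FB] Cseries Fmax Flim.
have almost_min n (a : T -> R) : exists2 g, C n g & forall t M, C n t ->
    (forall y, a y + F t y <= M) -> forall y, a y + F g y <= M + eps / 2 ^+ n.+1.
  set E := [set M | exists2 t, C n t & forall y, a y + F t y <= M].
  (* If no [a + F t] with [t] in [C n] is bounded above, the requirement on [g] is vacuous. *)
  have [E0|E0] := pselect (E !=set0); last first.
    have [g Cg] := C0 n; exists g => // t M Ct tM.
    by exfalso; apply: E0; exists M, t.
  have infE : has_inf E.
    split=> //; exists (a x0 - B) => M [t Ct] /(_ x0); apply: le_trans.
    by rewrite lerD2l (FB n).
  have d0 : 0 < eps / 2 ^+ n.+1 by rewrite divr_gt0// exprn_gt0.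
  have [M [g Cg gM] Mlt] := inf_adherent d0 infE.
  exists g => // t M' Ct tM' y; apply: (le_trans (gM y)).
  rewrite (le_trans (ltW Mlt))// lerD2r.
  by apply: ge_inf; [case: infE|exists t].
pose G n a := projT1 (cid2 (almost_min n a)).
have CG n a : C n (G n a) by rewrite /G; case: cid2.
have GP n a : forall t M, C n t -> (forall y, a y + F t y <= M) ->
    forall y, a y + F (G n a) y <= M + eps / 2 ^+ n.+1.
  by rewrite /G; case: cid2.
pose a := fix a n : T -> R :=
  if n is m.+1 then fun y => 2 * a m y + F (G m (a m)) y else fun=> 0.
have [t tP] := Cseries (fun n => G n (a n)) (fun n => CG n (a n)).
(* Unfolding the recursion of [t] moves the first [n] terms of the series into [a n]. *)
have ht n y : 2 ^+ n * F (t 0%N) y = a n y + F (t n) y.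
  elim: n => [|n IHn]; first by rewrite expr0 mul1r add0r.
  rewrite exprS -mulrA IHn /= (tP n).2.
  by lra.
have [x xmax] := Fmax _ (tP 0%N).1.
have step n y : a n y + F (G n (a n)) y <=
    2 ^+ n * F (t 0%N) x + eps / 2 ^+ n.+1.
  (* [t n] competes with [G n (a n)], and by [ht] and the choice of [x] its bound is
     [2 ^+ n * F (t 0%N) x]. *)
  apply: GP (tP n).1 _ y => y.
  by rewrite -ht ler_pM2l ?exprn_gt0.
(* [a n.+1] is [a n] plus the quantity bounded in [step]; the errors [eps / 2 ^+ k.+1] for [k < n]
   sum to [eps * (1 - (2 ^+ n)^-1)]. *)
have abound n y : a n y <= (2 ^+ n - 1) * F (t 0%N) x + eps * (1 - (2 ^+ n)^-1).
  elim: n => [|n IHn]; first by rewrite expr0 /= invr1 !subrr mul0r mulr0 addr0.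
  have := lerD (step n y) IHn; rewrite /=.
  rewrite addrAC -mulr2n -(mulr_natl (a n y)) => /le_trans; apply.
  rewrite le_eqVlt; apply/orP; left; apply/eqP.
  rewrite exprS; field; by rewrite expf_neq0.
(* At [x] the tail [F (t n) x] is at most [eps]; cancelling [(2 ^+ n - 1) * F (t 0%N) x] leaves
   [F (t 0%N) x <= 2 * eps]. *)
have [n Fn] := Flim x; exists (t 0%N); first exact: (tP 0%N).1.
move=> y; apply: (le_trans (xmax y)).
have := ht n x; have := abound n x; have := Fn _ (tP n).1.
have : 0 <= eps * (2 ^+ n)^-1 by rewrite mulr_ge0 ?ltW// invr_ge0 exprn_ge0.
by lra.
Qed.

End Simons.

(** * Closed convex hulls of tails, and geometric series in them *)

Section Hull.
Variables (R : realType) (A : completeNormedModType R[i]).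
Implicit Types (p : A -> R) (e g : nat -> A).

(** Convexity carries an upper bound to convex combinations, the Lipschitz condition carries it to
    norm limits. *)
Definition convex_lipschitz p :=
  (exists2 L, 0 <= L & forall x y, p x <= p y + L * nrm (x - y)) /\
  (forall x y t, 0 <= t <= 1 ->
     p (t%:C%C *: x + (1 - t)%:C%C *: y) <= t * p x + (1 - t) * p y).

(* By Hahn-Banach this is the closed convex hull of the [e k] with [n <= k]. *)
Definition tail_hull e n : set A :=
  [set y | forall p, convex_lipschitz p ->
     (forall k, (n <= k)%N -> p (e k) <= 0) -> p y <= 0].

Lemma tail_hull_mem e n k : (n <= k)%N -> tail_hull e n (e k).
Proof. by move=> nk p _; apply. Qed.

Lemma tail_hull_sub e e' m n : (forall k, (n <= k)%N -> tail_hull e' m (e k)) ->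
  tail_hull e n `<=` tail_hull e' m.
Proof. by move=> ee' y hy p pL pe; apply: hy => // k /ee'; exact. Qed.

Lemma tail_hull_anti e m n : (m <= n)%N -> tail_hull e n `<=` tail_hull e m.
Proof.
by move=> mn; apply: tail_hull_sub => k /(leq_trans mn); exact: tail_hull_mem.
Qed.

Lemma tail_hull_shift e m n :
  tail_hull (fun k => e (m + k)%N) n = tail_hull e (m + n)%N.
Proof.
apply/seteqP; split; apply: tail_hull_sub => k nk.
  by apply: tail_hull_mem; rewrite leq_add2l.
have mk : (m <= k)%N := leq_trans (leq_addr n m) nk.
by move=> p _ /(_ (k - m)%N); rewrite subnKC//; apply; rewrite leq_subRL.
Qed.

Lemma tail_hull_nrm e n y : (forall k, nrm (e k) <= 1) -> tail_hull e n y ->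
  nrm y <= 1.
Proof.
move=> e1 /(_ (fun x => nrm x - 1)); rewrite subr_le0; apply.
  split.
    exists 1 => // x z; have := ler_nrmD z (x - z).
    by rewrite addrC subrK; lra.
  move=> x z t /andP[t0 t1]; apply: (@le_trans _ _ (t * nrm x + (1 - t) * nrm z - 1)).
    by rewrite lerD2r (le_trans (ler_nrmD _ _))// !nrmZ// subr_ge0.
  by lra.
by move=> k _; rewrite subr_le0.
Qed.

Section Geometric.
Variables (r : R) (r01 : 0 < r < 1).
Let q := 1 - r.

(** This is the sum of [r * q ^+ k] times [g k] over [k < m], arranged so that the first term splits
    off by computation. *)
Fixpoint geom_sum g m : A :=
  if m is m'.+1 then
    r%:C%C *: g 0%N + q%:C%C *: geom_sum (fun k => g k.+1) m' else 0.

Let q0 : 0 <= q. Proof. by rewrite /q; case/andP: r01; lra. Qed.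
Let q1 : 0 <= q < 1. Proof. by rewrite /q; case/andP: r01; lra. Qed.
Let r0 : 0 <= r. Proof. by case/andP: r01; lra. Qed.

Lemma nrm_geom_sum g m : (forall k, nrm (g k) <= 1) -> nrm (geom_sum g m) <= 1.
Proof.
elim: m g => [|m IHm] g g1 /=; first by rewrite nrm0.
rewrite (le_trans (ler_nrmD _ _))// !nrmZ//.
have := ler_wpM2l r0 (g1 0%N).
have := ler_wpM2l q0 (IHm _ (fun k => g1 k.+1)).
by rewrite /q; lra.
Qed.

(** Once the first [m] terms cancel, there remains [q ^+ m] times a shifted partial sum, of norm at
    most 1. *)
Lemma geom_sum_cauchy g m n : (forall k, nrm (g k) <= 1) -> (m <= n)%N ->
  nrm (geom_sum g n - geom_sum g m) <= q ^+ m.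
Proof.
elim: m n g => [|m IHm] [|n] g g1 //= mn; first by rewrite subrr nrm0 expr0.
  by rewrite subr0 expr0 (@nrm_geom_sum g n.+1).
rewrite opprD addrACA subrr add0r -scalerBr nrmZ// exprS ler_wpM2l//.
exact: IHm.
Qed.

Lemma geom_sum_cvg g : (forall k, nrm (g k) <= 1) ->
  exists x, forall m, nrm (geom_sum g m - x) <= q ^+ m.
Proof.
move=> g1.
have [x /cvg_nrmP gx] : exists x : A, geom_sum g @ \oo --> x.
  apply: cauchy_nrm_cvg => eps eps0; have [N NP] := exprn_small q1 eps0.
  by exists N => n Nn; exact: le_lt_trans (geom_sum_cauchy g1 Nn) (NP _ _).
exists x => m; apply/ler_addgt0Pr => eps eps0.
have [N NP] := gx _ eps0; pose n := maxn m N.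
rewrite (le_trans (ler_nrm_dist _ (geom_sum g n) _))// lerD//.
  by rewrite nrmB geom_sum_cauchy// leq_maxl.
by rewrite ltW// NP// leq_maxr.
Qed.

(** The weights of the partial sum add up to [1 - q ^+ m]; that of [y] completes them to a convex
    combination. *)
Lemma geom_sum_hull e n g m y : (forall k, tail_hull e n (g k)) ->
  tail_hull e n y -> tail_hull e n (geom_sum g m + (q ^+ m)%:C%C *: y).
Proof.
elim: m g => [|m IHm] g hg hy; first by rewrite expr0 add0r scale1r.
rewrite /= -addrA exprS rmorphM -scalerA -scalerDr => p [pL pC] pe.
apply: (le_trans (pC _ _ _ _)); first by rewrite r0 -subr_ge0.
have := ler_wpM2l r0 (hg 0%N p (conj pL pC) pe).
have := ler_wpM2l q0 (IHm _ (fun k => hg k.+1) hy p (conj pL pC) pe).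
by rewrite /q; lra.
Qed.

(** [t n] is the infinite series of the [r * q ^+ k] times [g (n + k)]; membership passes to the
    limit through the test functions [p]. *)
Lemma geometric_series_hull e g : (forall k, nrm (e k) <= 1) ->
  (forall n, tail_hull e n (g n)) ->
  exists t, forall n, tail_hull e n (t n) /\
    t n = r%:C%C *: g n + (1 - r)%:C%C *: t n.+1.
Proof.
move=> e1 hg.
have g1 n k : nrm (g (n + k)%N) <= 1 by exact: tail_hull_nrm (hg _).
have /choice[t tP] n : exists x, forall m,
    nrm (geom_sum (fun k => g (n + k)%N) m - x) <= q ^+ m.
  by apply: geom_sum_cvg => k; exact: g1.
exists t => n; split.
  move=> p pcl pe; have [[L L0 pL] _] := pcl.
  apply/ler_addgt0Pr => eps eps0; rewrite add0r.
  (* [t n] lies within [2 * q ^+ m] of the completed partial sum [s], so [p (t n)] exceeds [p s] by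
     at most [2 * L * q ^+ m]; [L + 1] avoids a zero denominator. *)
  have d0 : 0 < eps / (2 * (L + 1)) by rewrite divr_gt0//; lra.
  have [m /(_ m (leqnn m)) mP] := exprn_small q1 d0.
  have hgn k : tail_hull e n (g (n + k)%N).
    exact: tail_hull_anti (leq_addr _ _) _ (hg _).
  have := @geom_sum_hull e n (fun k => g (n + k)%N) m (g n) hgn (hg n) p pcl pe.
  set s := (X in p X) => ps; apply: (le_trans (pL _ s)).
  have tns : nrm (t n - s) <= 2 * q ^+ m.
    rewrite (le_trans (ler_nrm_dist _ (geom_sum (fun k => g (n + k)%N) m) _))//.
    have := tP n m; rewrite nrmB => tnm.
    have -> : nrm (geom_sum (fun k => g (n + k)%N) m - s) = q ^+ m * nrm (g n).
      by rewrite /s opprD addNKr nrmN nrmZ// exprn_ge0.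
    have := g1 n 0%N; rewrite addn0 => gn1.
    have := ler_wpM2l (exprn_ge0 m q0) gn1.
    by lra.
  have := ler_wpM2l L0 tns; move: mP.
  rewrite ltr_pdivlMr; last by lra.
  have := exprn_ge0 m q0.
  by nra.
(* Both sides are within [q ^+ m.+1] of the partial sum with [m.+1] terms. *)
apply/eqP; rewrite -subr_eq0; apply/eqP/nrm_eq0_small => eps eps0.
have d0 : 0 < eps / 2 by rewrite divr_gt0.
have [m /(_ m.+1 (leqnSn m)) mP] := exprn_small q1 d0.
rewrite (le_trans (ler_nrm_dist _ (geom_sum (fun k => g (n + k)%N) m.+1) _))//.
have := tP n m.+1; rewrite nrmB => tnm.
have -> : nrm (geom_sum (fun k => g (n + k)%N) m.+1 -
    (r%:C%C *: g n + (1 - r)%:C%C *: t n.+1)) =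
    q * nrm (geom_sum (fun k => g (n.+1 + k)%N) m - t n.+1).
  rewrite /= addn0 opprD addrACA subrr add0r -scalerBr nrmZ//.
  by congr (_ * nrm (geom_sum _ _ - _)); apply/funext => k; rewrite addnS.
have := ler_wpM2l q0 (tP n.+1 m); rewrite -exprS.
by lra.
Qed.

End Geometric.
End Hull.

(** * The pointwise topology and weak* compactness of [Q_e] *)

Lemma ler_nrm_ReIm (R : realType) (z : R[i]) :
  nrm z <= `|complex.Re z| + `|complex.Im z|.
Proof.
rewrite /nrm normc_def/=.
have h : 0 <= `|complex.Re z| + `|complex.Im z| by rewrite addr_ge0.
rewrite -[leRHS](ger0_norm h) -sqrtr_sqr ler_wsqrtr// sqrrD !real_normK ?num_real//.
by rewrite addrAC lerDl mulrn_wge0// mulr_ge0.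
Qed.

Lemma Re_continuous (R : realType) : continuous (@complex.Re R : R[i] -> R).
Proof.
move=> z; apply: (cvgrPdist_lt (FF := nbhs_filter z) _ _).2 => eps eps0.
have eps0' : 0 < eps%:C%C by rewrite ltcR.
have := nbhsx_ballx z _ eps0'; apply: filterS => w.
rewrite -ball_normE /= -nrmE ltcR => /le_lt_trans; apply.
by rewrite -raddfB/= ler_Re_nrm.
Qed.

Lemma compact_complex_square (R : realType) (r : R) :
  compact [set z : R[i] | (complex.Re z \in `[-r, r]%R) /\
                          (complex.Im z \in `[-r, r]%R)].
Proof.
pose f (p : R * R) : R[i] := Complex p.1 p.2.
have -> : [set z | (complex.Re z \in `[-r, r]%R) /\
                   (complex.Im z \in `[-r, r]%R)] =
    f @` (`[-r, r] `*` `[-r, r]).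
  apply/seteqP; split=> [[a b] [/= ar br]|_ [[a b] [/= ar br] <-]//].
  by exists (a, b).
apply: (@continuous_compact (R * R)%type R[i] f); last first.
  by apply: compact_setX; exact: segment_compact.
apply: continuous_subspaceT => -[a b].
apply: (cvgrPdist_lt (FF := nbhs_filter ((a, b) : R * R)) _ _).2
  => _ /ltc_posP[d d0 ->].
have d20 : 0 < d / 2 by rewrite divr_gt0.
exists (ball a (d / 2), ball b (d / 2)).
  by split; exact: nbhsx_ballx.
move=> [a' b'] /= [aa bb].
rewrite -ball_normE /= in aa bb.
by rewrite -nrmE ltcR (le_lt_trans (ler_nrm_ReIm _))//=; lra.
Qed.

Section WeakStar.
Variables (R : realType) (A : completeNormedModType R[i]).
Implicit Types (phi psi : A -> R[i]).

Lemma dual_ball_nrm phi x : dual_ball phi -> nrm (phi x) <= nrm x.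
Proof. by move=> [_ /(_ x)]; rewrite -!nrmE lecR. Qed.

Lemma dual_bound phi : clinear phi -> (forall x, `|phi x| <= `|x|) -> dual phi.
Proof.
move=> lin bnd; split=> // x; apply/cvgrPdist_lt => eps eps0.
have := nbhsx_ballx x _ eps0; apply: filterS => y.
rewrite -ball_normE /=; apply: le_lt_trans.
rewrite -[x in phi x - _](subrK y).
by rewrite -[x - y]scale1r lin scale1r mul1r addrK.
Qed.

Lemma ptws_eval_continuous x : continuous (fun phi : {ptws A -> R[i]} => phi x).
Proof. exact: (@proj_continuous A (fun=> R[i]) x). Qed.

(** Three points suffice to test linearity: [c *: x + y], [x] and [y]. *)
Lemma ptws_closure_near (Q : set (A -> R[i])) psi x y z (eps : R) :
  @closure {ptws A -> R[i]} Q psi -> 0 < eps ->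
  exists phi, [/\ Q phi, nrm (psi x - phi x) < eps,
    nrm (psi y - phi y) < eps & nrm (psi z - phi z) < eps].
Proof.
move=> Qpsi eps0.
pose S w : set {ptws A -> R[i]} := [set phi | nrm (psi w - phi w) < eps].
have near w : nbhs (psi : {ptws A -> R[i]}) (S w).
  have /cvgrPdist_lt/(_ eps%:C%C) := @ptws_eval_continuous w psi.
  by rewrite ltcR => /(_ eps0); apply: filterS => phi; rewrite -nrmE ltcR.
have nearS : nbhs (psi : {ptws A -> R[i]}) (S x `&` S y `&` S z).
  by apply: filterI; [apply: filterI|]; exact: near.
have [phi [Qphi [[hx hy] hz]]] := Qpsi _ nearS.
by exists phi.
Qed.

Variables (e : nat -> A).

Lemma Q_e_dual_ball : Q_e e `<=` @dual_ball R A.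
Proof.
move=> _ [t [phi [[[lin cont] bnd] _] [t0 t1 ->]]].
have bnd' x : `|t%:C%C * phi x| <= `|x|.
  have t0' : 0 <= t%:C%C by rewrite ler0c.
  have t1' : t%:C%C <= 1 by rewrite -[1]/(1%:C)%C lecR.
  by rewrite normrM (le_trans _ (bnd x))// ler_piMl// ger0_norm.
split; last exact: bnd'.
apply: dual_bound bnd' => c x y.
by rewrite lin mulrDr mulrCA.
Qed.

(** As in Banach-Alaoglu, values at [x] stay in a compact square and Tychonoff applies. A pointwise
    limit of [Q_e e] is again linear and bounded by the norm, so closedness in the dual gives
    closedness among all functions. *)
Lemma Q_e_compact : weakstar_closed (Q_e e) ->
  compact (Q_e e : set {ptws A -> R[i]}).
Proof.
move=> [_ Qclosed].
pose K (x : A) : set R[i] :=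
  [set z | (complex.Re z \in `[- nrm x, nrm x]%R) /\
           (complex.Im z \in `[- nrm x, nrm x]%R)].
apply: (@subclosed_compact {ptws A -> R[i]} _ [set f | forall x, K x (f x)]).
- move=> psi clpsi; apply: Qclosed; split=> //; apply: dual_bound.
    move=> c x y; apply/eqP; rewrite -subr_eq0; apply/eqP/nrm_eq0_small => eps eps0.
    (* The errors at [c *: x + y], [x] and [y] enter with weights 1, [nrm c] and 1. *)
    pose d := eps / (2 + nrm c).
    have c0 := nrm_ge0 c.
    have d0 : 0 < d by rewrite divr_gt0//; lra.
    have [phi [/Q_e_dual_ball[[lin _] _] h1 h2 h3]] :=
      ptws_closure_near (c *: x + y) x y clpsi d0.
    have -> : psi (c *: x + y) - (c * psi x + psi y) =
        (psi (c *: x + y) - phi (c *: x + y)) -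
        (c * (psi x - phi x)) - (psi y - phi y).
      by rewrite lin; ring.
    rewrite (le_trans (ler_nrmD _ _))// nrmN.
    have := ler_nrmD (psi (c *: x + y) - phi (c *: x + y)) (- (c * (psi x - phi x))).
    rewrite nrmN.
    have -> : nrm (c * (psi x - phi x)) = nrm c * nrm (psi x - phi x).
      by apply: complexI; rewrite rmorphM !nrmE normrM.
    have : d * (2 + nrm c) = eps by rewrite /d divfK//; lra.
    have := ler_wpM2l c0 (ltW h2).
    by lra.
  move=> x; rewrite -!nrmE lecR; apply/ler_addgt0Pr => eps eps0.
  have [phi [/Q_e_dual_ball/(dual_ball_nrm x) bnd h1 _ _]] :=
    ptws_closure_near x x x clpsi eps0.
  have := ler_nrmD (phi x) (psi x - phi x).
  by rewrite addrC subrK; lra.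
- by apply: tychonoff => x; exact: compact_complex_square.
- move=> psi /Q_e_dual_ball bpsi x; have := dual_ball_nrm x bpsi.
  rewrite /K /= !in_itv /= -!ler_norml => h; split.
    exact: le_trans (ler_Re_nrm _) h.
  apply: le_trans h.
  by rewrite /nrm normc_def/= -sqrtr_sqr ler_wsqrtr// lerDr sqr_ge0.
Qed.

End WeakStar.

(** * Real parts of linear functionals *)

Section RealPart.
Variables (R : realType) (A : completeNormedModType R[i]).
Variables (phi : A -> R[i]) (lin : clinear phi).

Lemma clinearD x y : phi (x + y) = phi x + phi y.
Proof. by have := lin 1 x y; rewrite scale1r mul1r. Qed.

Lemma clinear0 : phi 0 = 0.
Proof. by apply: (addrI (phi 0)); rewrite addr0 -clinearD addr0. Qed.

Lemma Re_clinearD x y :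
  complex.Re (phi (x + y)) = complex.Re (phi x) + complex.Re (phi y).
Proof. by rewrite clinearD raddfD. Qed.

Lemma Re_clinearN x : complex.Re (phi (- x)) = - complex.Re (phi x).
Proof. by have := Re_clinearD x (- x); rewrite subrr clinear0 /=; lra. Qed.

Lemma Re_realM (t : R) (w : R[i]) :
  complex.Re (t%:C%C * w) = t * complex.Re w.
Proof. by case: w => u v /=; rewrite mul0r subr0. Qed.

Lemma Re_clinearZ (t : R) x :
  complex.Re (phi (t%:C%C *: x)) = t * complex.Re (phi x).
Proof. by rewrite -Re_realM -[_ *: x]addr0 lin clinear0 addr0. Qed.

End RealPart.

(** * Approximate identities and positivity in the tail hulls *)

Section Positive.
Variables (R : realType) (A : completeNormedModType R[i]).
Variables (e : nat -> A).
Hypothesis e1 : forall k, nrm (e k) <= 1.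

Lemma dual_ball_Re (phi : A -> R[i]) x : dual_ball phi ->
  `|complex.Re (phi x)| <= nrm x.
Proof.
by move=> bphi; exact: le_trans (ler_Re_nrm _) (dual_ball_nrm x bphi).
Qed.

(** The inequality defines a closed half-space that contains [e k] for all large [k], hence a whole
    tail hull. *)
Lemma S_e_tail_hull (phi : A -> R[i]) (eps : R) : S_e e phi -> 0 < eps ->
  exists n, forall y, tail_hull e n y -> 1 - eps <= complex.Re (phi y).
Proof.
move=> [bphi /cvg_nrmP phie] eps0; have [n nP] := phie _ eps0.
have lin := bphi.1.1.
exists n => y /(_ (fun x => 1 - eps - complex.Re (phi x))); rewrite subr_le0.
apply.
  split=> [|x z t _]; last by rewrite Re_clinearD// !Re_clinearZ//; lra.
  exists 1 => // x z; have := dual_ball_Re (z - x) bphi.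
  rewrite nrmB ler_norml => /andP[_].
  have := Re_clinearD lin x (z - x); rewrite addrC subrK.
  by lra.
move=> k /nP; have := ler_Re_nrm (phi (e k) - 1).
by rewrite raddfB /= ler_norml => /andP[+ _]; lra.
Qed.

(** For [T] the left or right multiplication by [a], [nrm (T x - a)] is convex and Lipschitz in [x],
    so its bound on the [e k] passes to the tail hull. *)
Lemma tail_hull_seq_cai (mul : A -> A -> A) (f : nat -> A) :
  banach_algebra_mul mul -> seq_cai mul e -> (forall n, tail_hull e n (f n)) ->
  seq_cai mul f.
Proof.
move=> [_ linl linr submul] [_ [el er]] hf.
have hullP (T : A -> A) (a : A) :
    (forall (c : R[i]) x y, T (c *: x + y) = c *: T x + T y) ->
    (forall x, nrm (T x) <= nrm x * nrm a) ->
    (fun n => T (e n)) @ \oo --> a -> (fun n => T (f n)) @ \oo --> a.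
  move=> lin bnd /cvg_nrmP Te; apply/cvg_nrmP => eps eps0.
  have d0 : 0 < eps / 2 by rewrite divr_gt0.
  have [N NP] := Te _ d0.
  exists N => n Nn.
  have TD x y : T (x + y) = T x + T y by have := lin 1 x y; rewrite !scale1r.
  have T0 : T 0 = 0 by apply: (addrI (T 0)); rewrite addr0 -TD addr0.
  have TZ c x : T (c *: x) = c *: T x by rewrite -[c *: x]addr0 lin T0 addr0.
  suff : nrm (T (f n) - a) - eps / 2 <= 0 by lra.
  apply: (tail_hull_anti Nn (hf n) (p := fun x => nrm (T x - a) - eps / 2)).
    split=> [|x y t /andP[t0 t1]].
      exists (nrm a) => [|x y]; first exact: nrm_ge0.
      have := ler_nrm_dist (T x) (T y) a; have := bnd (x - y).
      have -> : T (x - y) = T x - T y by rewrite -scaleN1r TD TZ scaleN1r.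
      by lra.
    have -> : T (t%:C%C *: x + (1 - t)%:C%C *: y) - a =
        t%:C%C *: (T x - a) + (1 - t)%:C%C *: (T y - a).
      rewrite lin TZ !scalerBr addrACA -opprD -scalerDl.
      by rewrite -rmorphD subrKC scale1r.
    have := ler_nrmD (t%:C%C *: (T x - a)) ((1 - t)%:C%C *: (T y - a)).
    by rewrite !nrmZ ?subr_ge0//; lra.
  by move=> k /NP/ltW; lra.
have submul' x y : nrm (mul x y) <= nrm x * nrm y.
  by rewrite -lecR rmorphM/= !nrmE.
split; last split.
- by move=> n; rewrite -nrmE (lecR _ 1); exact: tail_hull_nrm (hf n).
- by move=> a; apply: (hullP (mul^~ a)) => //.
- move=> a; apply: (hullP (mul a)) => //.
  by move=> x; rewrite mulrC.
Qed.

Hypothesis Qclosed : weakstar_closed (Q_e e).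

Lemma Q_e_attains_max (y : A) : S_e e !=set0 ->
  exists2 psi, Q_e e psi & forall psi', Q_e e psi' ->
    complex.Re (psi' y) <= complex.Re (psi y).
Proof.
move=> [phi Sphi].
have Q0 : Q_e e !=set0.
  by exists (fun x => 1%:C%C * phi x), 1, phi.
have cont : {within (Q_e e : set {ptws A -> R[i]}),
    continuous (fun psi : {ptws A -> R[i]} => complex.Re (psi y))}.
  apply: continuous_subspaceT => psi.
  exact: (continuous_comp (@ptws_eval_continuous R A y psi)
    (@Re_continuous R (psi y))).
have [psi Qpsi psimax] :=
  @compact_EVT_max {ptws A -> R[i]} R _ _ Q0 (Q_e_compact Qclosed) cont.
exists psi; first by move: Qpsi; rewrite inE.
by move=> psi' Qpsi'; apply: psimax; rewrite inE.
Qed.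

(** The boolean index lets a single [g] serve two vectors at once, later [a] and 0. *)
Lemma tail_hull_almost_positive (z : bool -> A) (r : R) N (eps : R) :
  0 < r < 1 -> 0 < eps ->
  (forall phi, S_e e phi -> forall b, - r <= complex.Re (phi (z b))) ->
  exists2 g, tail_hull e N g & forall phi, S_e e phi ->
    forall b, - eps <= complex.Re (phi (z b + r%:C%C *: g)).
Proof.
move=> /andP[r0 r1] eps0 zr.
have [S0|noS] := pselect (S_e e !=set0); last first.
  exists (e N); first exact: tail_hull_mem.
  by move=> phi Sphi; exfalso; apply: noS; exists phi.
have S_Q phi : S_e e phi -> Q_e e phi.
  move=> Sphi; exists 1, phi => //; split=> //.
  by apply/funext => x; rewrite mul1r.
have [phi0 Sphi0] := S0.
pose T := ({psi : A -> R[i] | Q_e e psi} * bool)%type.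
pose F (g : A) (x : T) := - complex.Re (sval x.1 (z x.2 + r%:C%C *: g)).
have Qlin (x : T) : clinear (sval x.1) := (Q_e_dual_ball (svalP x.1)).1.1.
have FE g x : F g x =
    - (complex.Re (sval x.1 (z x.2)) + r * complex.Re (sval x.1 g)).
  by rewrite /F Re_clinearD// Re_clinearZ.
(* [eps / 3] absorbs the factor 3 of [simons]; shifting the hulls by [N] puts [v] in the required
   one. *)
have [||||||v Cv Fv] := @simons R A T F (fun n => tail_hull e (N + n)%N)
    (exist _ phi0 (S_Q _ Sphi0), true) (eps / 3).
- by rewrite divr_gt0.
- by move=> n; exists (e (N + n)%N); exact: tail_hull_mem.
- exists (complex.Re (phi0 (z true)) + 1) => n v hv; rewrite FE /= lerN2 lerD2l.
  have v1 := tail_hull_nrm e1 hv.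
  have := dual_ball_Re v Sphi0.1; rewrite ler_norml => /andP[_ h].
  by nra.
- move=> g hg.
  have half : 0 < (1 / 2 : R) < 1 by apply/andP; split; lra.
  have [||t tP] := geometric_series_hull half (e := fun k => e (N + k)%N) (g := g).
  + by move=> k.
  + by move=> n; rewrite tail_hull_shift.
  exists t => n; have [ht tE] := tP n; rewrite -tail_hull_shift; split=> // x.
  by rewrite !FE {1}tE Re_clinearD// !Re_clinearZ//; lra.
(* Compactness yields a maximum for each boolean; the larger of the two is taken. *)
- move=> v _.
  have maxb b : exists x : T, forall y : T, y.2 = b -> F v y <= F v x.
    have [psi Qpsi psimax] := Q_e_attains_max (- (z b + r%:C%C *: v)) S0.
    exists (exist _ psi Qpsi, b) => -[[psi' Qpsi'] b'] /= ->.
    have := psimax _ Qpsi'.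
    by rewrite /F /= !Re_clinearN//;
      [case: (Q_e_dual_ball Qpsi)|case: (Q_e_dual_ball Qpsi')] => -[].
  have [xt xtP] := maxb true; have [xf xfP] := maxb false.
  have [h|h] := lerP (F v xt) (F v xf).
    by exists xf => -[psi []]; [rewrite (le_trans _ h)// xtP|exact: xfP].
  by exists xt => -[psi []]; [exact: xtP|rewrite (le_trans _ (ltW h))// xfP].
- move=> [[psi Qpsi] b].
  (* At [t] times [phi], the term of [z b] is at least [- (t * r)] and that of [v] at least
     [t * r * (1 - eps / 3)], so the sum is at least [- (eps / 3)]. *)
  have [t [phi Sphi [t0 t1 psiE]]] := Qpsi.
  have d0 : 0 < eps / 3 by rewrite divr_gt0.
  have [n nP] := S_e_tail_hull Sphi d0.
  exists n => v /(tail_hull_anti (leq_addl _ _))/nP phiv.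
  rewrite FE /= psiE !Re_realM.
  have zb := ler_wpM2l t0 (zr _ Sphi b).
  have := ler_wpM2l (mulr_ge0 t0 (ltW r0)) phiv.
  have tr1 : t * r <= 1 by rewrite mulr_ile1// ltW.
  by have := ler_wpM2r (ltW d0) tr1; lra.
exists v; first by rewrite addn0 in Cv.
move=> phi Sphi b; have := Fv (exist _ phi (S_Q _ Sphi), b).
by rewrite /F /=; lra.
Qed.

(* With [q = 1 - r], the series [f] of the [r q ^ n g_n] is built so that the
   partial sum [q ^ n Z_n] of [z + f] is at least [- r q ^ n] on [S_e e]. *)
Lemma tail_hull_positive (a : A) (c : R) N : -1 < c ->
  (forall phi, S_e e phi -> c <= complex.Re (phi a)) ->
  exists2 f, tail_hull e N f & r_e e f /\ r_e e (f + a).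
Proof.
(* [- c <= r] makes [a] admissible at the start, [1 / 2] keeps [r] positive, and [-1 < c] gives
   [r < 1]. *)
move=> c1 ca; pose r := Num.max (- c) (1 / 2); pose q := 1 - r.
have cr : - c <= r by rewrite /r le_max lexx.
have r01 : 0 < r < 1.
  rewrite /r lt_max gt_max; apply/andP.
  by split; [apply/orP; right|apply/andP; split]; lra.
have /andP[r0 r1] := r01.
have q0 : 0 < q by rewrite /q; lra.
pose good (z : bool -> A) :=
  forall phi, S_e e phi -> forall b, - r <= complex.Re (phi (z b)).
(* The error [r * q] becomes [r] again after division by [q]. A default [e] for vectors that are not
   [good] allows [Z] to be defined before [goodZ] is proved. *)
have /choice[G GP] (nz : nat * (bool -> A)) : exists g, tail_hull e (N + nz.1)%N g /\
    (good nz.2 -> forall phi, S_e e phi ->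
       forall b, - (r * q) <= complex.Re (phi (nz.2 b + r%:C%C *: g))).
  have [gz|ngz] := pselect (good nz.2); last first.
    by exists (e (N + nz.1)%N); split=> //; exact: tail_hull_mem.
  have [g hg gP] := tail_hull_almost_positive (N + nz.1) r01 (mulr_gt0 r0 q0) gz.
  by exists g.
pose Z := fix Z n : bool -> A := if n is m.+1 then
  fun b => (q^-1)%:C%C *: (Z m b + r%:C%C *: G (m, Z m)) else
  fun b => if b then a else 0.
have goodZ n : good (Z n).
  elim: n => [|n IHn] phi Sphi b; have lin := Sphi.1.1.1.
    case: b => /=; first by have := ca _ Sphi; lra.
    by rewrite clinear0//=; lra.
  rewrite /= Re_clinearZ// mulrC ler_pdivlMr// mulNr.
  exact: (GP (n, Z n)).2.
have [||t tP] := geometric_series_hull r01 (e := fun k => e (N + k)%N)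
    (g := fun n => G (n, Z n)).
- by move=> k.
- by move=> n; rewrite tail_hull_shift; exact: (GP (n, Z n)).1.
have pos b phi : S_e e phi -> 0 <= complex.Re (phi (t 0%N + Z 0%N b)).
  move=> Sphi; have lin := Sphi.1.1.1.
  (* Passing from [n] to [n.+1], the term of [G (n, Z n)] leaves [t] and enters [Z], and a factor
     [q] comes out. *)
  have scale n : complex.Re (phi (t 0%N + Z 0%N b)) =
      q ^+ n * complex.Re (phi (t n + Z n b)).
    elim: n => [|n ->]; first by rewrite expr0 mul1r.
    rewrite exprSr -mulrA; congr (_ * _); rewrite !Re_clinearD//.
    rewrite (tP n).2 /= Re_clinearD// !Re_clinearZ// -/q Re_clinearD// Re_clinearZ//.
    by rewrite mulrDr mulVKf ?gt_eqF//; lra.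
  rewrite -oppr_le0; apply/ler_addgt0Pr => eps eps0; rewrite add0r.
  have q1 : 0 <= q < 1 by rewrite ltW//= /q; lra.
  have d0 : 0 < eps / 2 by rewrite divr_gt0.
  have [n /(_ n (leqnn n)) qn] := exprn_small q1 d0.
  have := goodZ n _ Sphi b.
  have t1 : nrm (t n) <= 1 by apply: tail_hull_nrm (tP n).1.
  have := dual_ball_Re (t n) Sphi.1; rewrite ler_norml => /andP[h1 _] h2.
  (* The two terms are at least -1 and [- r]; the factor [q ^+ n] then makes this bound
     negligible. *)
  have : - 2 <= complex.Re (phi (t n + Z n b)) by rewrite Re_clinearD//; lra.
  move=> /(ler_wpM2l (exprn_ge0 n (ltW q0))); rewrite -scale.
  by lra.
exists (t 0%N); first by have := (tP 0%N).1; rewrite tail_hull_shift addn0.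
split=> phi Sphi; last exact: (pos true).
by have := pos false _ Sphi; rewrite /= addr0.
Qed.

End Positive.

(** An infimum above -1 is expressed by a lower bound [c] with [-1 < c], which also covers an empty
    [S_e e], where the infimum is infinite. *)
Theorem theorem2p9 (R : realType) (A : completeNormedModType R[i])
  (mul : A -> A -> A) (e : nat -> A) :
  banach_algebra_mul mul -> seq_cai mul e -> weakstar_closed (Q_e e) ->
  (exists f : nat -> A, seq_cai mul f /\ (forall n, r_e e (f n))) /\
  (forall a : A,
     (exists2 c : R, -1 < c & forall phi, S_e e phi -> c <= complex.Re (phi a)) ->
     exists f : nat -> A,
       [/\ seq_cai mul f, (forall n, r_e e (f n)) & (forall n, r_e e (f n + a))]).
Proof.
move=> mulP caie Qclosed.
have e1 k : nrm (e k) <= 1 by rewrite -lecR nrmE; exact: caie.1.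
have main (a : A) :
    (exists2 c : R, -1 < c & forall phi, S_e e phi -> c <= complex.Re (phi a)) ->
    exists f : nat -> A,
      [/\ seq_cai mul f, (forall n, r_e e (f n)) & (forall n, r_e e (f n + a))].
  move=> [c c1 ca].
  have /choice[f fP] n : exists f, tail_hull e n f /\ (r_e e f /\ r_e e (f + a)).
    by have [f hf fP] := tail_hull_positive e1 Qclosed n c1 ca; exists f.
  exists f; split=> [|n|n]; last 2 first.
  - exact: (fP n).2.1.
  - exact: (fP n).2.2.
  by apply: tail_hull_seq_cai caie _ => // n; exact: (fP n).1.
split=> //.
have [|f [caif fpos _]] := main 0; last by exists f.
by exists 0 => [|phi [[[lin _] _] _]]; [rewrite ltrN10|rewrite clinear0].
Qed.
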